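(* There exist a stationary $1$-dependent $4$-coloring of $\mathbb{Z}$, and a stationary $2$-dependent $3$-coloring of $\mathbb{Z}$.
   Context: A stochastic process $X=(X_i)_{i\in\mathbb{Z}}$ is $k$-dependent if the random sequences $(\ldots,X_{i-2},X_{i-1})$ and $(X_{i+k},X_{i+k+1},\ldots)$ are independent of each other, for each $i\in\mathbb{Z}$. It is stationary if $(X_i)_{i\in\mathbb{Z}}$ and $(X_{i+1})_{i\in\mathbb{Z}}$ are equal in law. It is a $q$-coloring (of $\mathbb{Z}$) if each $X_i$ takes values in $\{1,\ldots,q\}$ and almost surely $X_i\neq X_{i+1}$ for all $i\in\mathbb{Z}$. *)

(* Defs.v *)
From HB Require Import structures.
From mathcomp Require Export all_boot all_order all_algebra.
From mathcomp Require Export all_classical all_reals all_analysis.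

Set Implicit Arguments.
Unset Strict Implicit.
Unset Printing Implicit Defensive.

Import Order.TTheory GRing.Theory Num.Theory.

Local Open Scope classical_set_scope.
Local Open Scope ring_scope.

(* The product sigma-algebra on I -> E, generated by the coordinate maps.
   The index type I is arbitrary, so this covers sequences indexed by nat as
   well as by int. *)
Definition product_sigma_algebra (I : Type) (d : measure_display)
    (E : measurableType d) : set (set (I -> E)) :=
  <<s \bigcup_(i in [set: I])
        preimage_set_system [set: I -> E] (fun x : I -> E => x i) measurable >>.

Section random_families.
Context {d d' : measure_display} {T : measurableType d} {E : measurableType d'}
  {R : realType} {P : probability T R}.

(* The event that the random family (Y_i)_i, seen as one random element of
   I -> E, lies in A. *)
Definition family_event (I : Type) (Y : I -> {RV P >-> E}) (A : set (I -> E)) :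
  set T := [set w | A (fun i => Y i w)].

Definition equal_in_law (I : Type) (Y Z : I -> {RV P >-> E}) : Prop :=
  forall A, product_sigma_algebra A ->
    P (family_event Y A) = P (family_event Z A).

Definition independent_families (I J : Type) (Y : I -> {RV P >-> E})
    (Z : J -> {RV P >-> E}) : Prop :=
  forall A B, product_sigma_algebra A -> product_sigma_algebra B ->
    P (family_event Y A `&` family_event Z B)
    = (P (family_event Y A) * P (family_event Z B))%E.

(* The one-sided sequence ending at X_(i-1) is listed backwards, the n-th term
   being X_(i-1-n). *)
Definition k_dependent (k : nat) (X : int -> {RV P >-> E}) : Prop :=
  forall i : int,
    independent_families (fun n : nat => X (i - 1 - n%:Z))
                         (fun n : nat => X (i + k%:Z + n%:Z)).

Definition stationary (X : int -> {RV P >-> E}) : Prop :=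
  equal_in_law X (fun i => X (i + 1)).

End random_families.

(* nat carries the discrete sigma-algebra. *)
Definition q_coloring (d : measure_display) (T : measurableType d)
    (R : realType) (P : probability T R) (q : nat)
    (X : int -> {RV P >-> nat}) : Prop :=
  (forall i w, (1 <= X i w <= q)%N) /\
  {ae P, forall w, forall i, X i w <> X (i + 1) w}.

(* Main.v *)
From HB Require Import structures.
Require Import Defs.
From mathcomp Require Import ring zify.

Import Order.TTheory GRing.Theory Num.Theory.

Local Open Scope classical_set_scope.
Local Open Scope ring_scope.

Set Implicit Arguments.
Unset Strict Implicit.
Unset Printing Implicit Defensive.

(** Both colorings come from one combinatorial recursion, due to Holroyd and
Liggett.  Build a word by inserting its letters one at a time, in any order,
so that equal letters are never adjacent at any stage.  Let B(x) be the number
of ways to obtain x: B is 1 on the empty word, B(x) = 0 if x has two equal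
adjacent letters, and otherwise B(x) is the sum of B over the words obtained
from x by deleting one letter.  The law of the coloring on a block of n
consecutive sites is B(x) / (2^n (n+1)!) for 4 colors and 2 B(x) / (n+2)! for
3 colors.

Three identities for B carry the proof.
- [build_sum_rcons]: with q letters, appending an arbitrary letter to a word
  of length n multiplies B by n (q - 2) + q.  With the invariance of B under
  reversal, this makes the block laws consistent at both ends.
- [build_gap1]: for q = 4 and words x, y of lengths m, n, the sum of B(x a y)
  over the letters a is 2 C(m+n+2, m+1) B(x) B(y).
- [build_gap2]: for q = 3, the sum of B(x a b y) over the letters a, b is
  2 C(m+n+4, m+2) B(x) B(y).
After normalization, the last two say that blocks separated by one site
(q = 4) or by two sites (q = 3) are independent.  All three go by induction
on the length.  Expanding B over one deletion, the sum over admissible middle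
letters differs from the sum over all letters only in the terms where the
deleted letter is next to the gap, and these terms cancel against those where
the deleted letter lies in the gap.  With one letter in the gap the
cancellation needs q - 2 = 2, with two letters it needs q - 2 = 1.

It remains to realize a consistent family of block laws by random variables.
On [0,1) with Lebesgue measure, nested half-open intervals are cut according
to a sequence of letters, which are then placed alternately at the right and
left ends of a growing window of integers ([block_law_process]).  Finally,
the pi-lambda theorem ([measure_family_unique]) carries stationarity and
independence from finite blocks to the product sigma-algebra
([equal_in_law_of_blocks], [independent_of_blocks]). *)

(** * Deleting a letter from a word *)

Section Deletions.
Variable T : eqType.
Implicit Types (a c d : T) (x y z : seq T).

Fixpoint deletions x : seq (seq T) :=
  if x is a :: y then y :: [seq a :: z | z <- deletions y] else [::].

Lemma deletions_cat x y :
  deletions (x ++ y) =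
  [seq z ++ y | z <- deletions x] ++ [seq x ++ z | z <- deletions y].
Proof.
elim: x => [|a x IH] /=; first by rewrite map_id.
by rewrite IH map_cat -!map_comp.
Qed.

Lemma size_deletions x y : y \in deletions x -> (size y).+1 = size x.
Proof.
elim: x y => [//|a x IH] y; rewrite inE => /predU1P[->//|/mapP[z zx ->]] /=.
by rewrite IH.
Qed.

Lemma deletions_rev x :
  perm_eq (deletions (rev x)) [seq rev y | y <- deletions x].
Proof.
elim: x => [//|a x IH]; rewrite rev_cons -cats1 deletions_cat /= cats0.
rewrite perm_catC /= perm_cons -map_comp.
have -> : [seq (rev \o cons a) z | z <- deletions x] =
          [seq y ++ [:: a] | y <- [seq rev z | z <- deletions x]].
  by rewrite -map_comp; apply: eq_map => z /=; rewrite rev_cons cats1.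
exact: perm_map.
Qed.

End Deletions.

(** * The number of buildings of a word *)

Section Buildings.
Variables (T : eqType) (S : seq T) (R : numFieldType).
Implicit Types (a b c d : T) (x y z : seq T).

(** Requiring the letters to lie in [S] as well makes [build] vanish on words
with foreign letters, so that the identities below hold for every word. *)
Definition proper x := all (mem S) x && sorted (fun a b => a != b) x.

Lemma proper_cat x c d y :
  proper (rcons x c ++ d :: y) =
  [&& proper (rcons x c), proper (d :: y) & c != d].
Proof.
rewrite /proper all_cat cat_rcons sorted_cat_cons /=.
by do !case: (all _ _) => //=; do !case: (_ \in _) => //=;
  rewrite ?andbF ?andbT //; case: (c != d); rewrite ?andbF ?andbT.
Qed.

Lemma proper_cons a d y :
  proper [:: a, d & y] = [&& a \in S, a != d & proper (d :: y)].
Proof.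
by rewrite /proper /=; case: (a \in S); case: (a != d); rewrite ?andbF.
Qed.

Lemma proper_catl x y : proper (x ++ y) -> proper x.
Proof.
case: (lastP x) => // {}x c; case: y => [|d y]; first by rewrite cats0.
by rewrite proper_cat => /and3P[].
Qed.

Lemma proper_catr x y : proper (x ++ y) -> proper y.
Proof.
case: (lastP x) => // {}x c; case: y => [//|d y].
by rewrite proper_cat => /and3P[].
Qed.

Lemma proper_rev x : proper (rev x) = proper x.
Proof.
rewrite /proper all_rev rev_sorted; congr (_ && _).
by apply: eq_sorted => a b; rewrite eq_sym.
Qed.

Lemma proper_mem x a y : proper (x ++ a :: y) -> a \in S.
Proof. by rewrite /proper all_cat /= => /andP[/and3P[]]. Qed.

(** [build_rec n] counts the buildings of the words of length [n]; the length
is the decreasing argument because a deletion is not a structural subterm. *)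
Fixpoint build_rec n x : R :=
  if n is m.+1 then (\sum_(y <- deletions x) build_rec m y) *+ proper x
  else (x == [::])%:R.

Definition build x := build_rec (size x) x.

Lemma build_nil : build [::] = 1.
Proof. by []. Qed.

Lemma buildE x : x != [::] ->
  build x = (\sum_(y <- deletions x) build y) *+ proper x.
Proof.
case: x => // a x _; rewrite {1}/build [size _]/= [LHS]/=.
congr (_ *+ _); apply: eq_big_seq => y yx.
by rewrite /build; have /size_deletions[->] : y \in deletions (a :: x) by [].
Qed.

Lemma build_proper x : proper x -> x != [::] ->
  build x = \sum_(y <- deletions x) build y.
Proof. by move=> px x0; rewrite buildE // px mulr1n. Qed.

Lemma build_improper x : ~~ proper x -> build x = 0.
Proof.
by move=> px; rewrite buildE ?(negbTE px) //; apply: contra px => /eqP ->.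
Qed.

Lemma build_ge0 x : 0 <= build x.
Proof.
rewrite /build; move: (size x) => n.
elim: n x => [|n IH] x /=; first by rewrite ler0n.
by rewrite mulrn_wge0 // sumr_ge0.
Qed.

Lemma build_rev x : build (rev x) = build x.
Proof.
have [n] := ubnP (size x); elim: n x => // n IH x le_xn.
have [->//|x0] := eqVneq x [::].
rewrite !buildE // ?proper_rev; last by rewrite -size_eq0 size_rev size_eq0.
congr (_ *+ _); rewrite (perm_big _ (deletions_rev x)) big_map.
by apply: eq_big_seq => y yx; rewrite IH // -ltnS (size_deletions yx).
Qed.

Lemma build_repeat x a y : build (x ++ a :: a :: y) = 0.
Proof.
by rewrite build_improper // -cat_rcons proper_cat eqxx !andbF.
Qed.

Hypothesis uniqS : uniq S.

Lemma sum_except (f : T -> R) c : c \in S ->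
  \sum_(a <- S) f a *+ (a != c) = \sum_(a <- S) f a - f c.
Proof.
move=> cS; rewrite !(bigD1_seq c) //= eqxx mulr0n add0r addrAC subrr add0r.
by apply: eq_bigr => a ->; rewrite mulr1n.
Qed.

Lemma sum_except2 (f : T -> R) c d : c \in S -> d \in S ->
  \sum_(a <- S) f a *+ ((a != c) && (a != d)) =
  \sum_(a <- S) f a - f c - f d *+ (c != d).
Proof.
move=> cS dS; rewrite eq_sym -sum_except // -(sum_except _ dS).
by apply: eq_bigr => a _; rewrite -mulrnA mulnb.
Qed.

Lemma deletions_rcons x a :
  deletions (rcons x a) = [seq rcons z a | z <- deletions x] ++ [:: x].
Proof.
rewrite -cats1 deletions_cat /= cats0; congr (_ ++ _).
by apply: eq_map => z; rewrite cats1.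
Qed.

Lemma proper_rcons_mem x c : proper (rcons x c) -> c \in S.
Proof. by rewrite -cats1 => /proper_mem. Qed.

(** A new letter [a] must differ from the last letter [c] of the word.  The
term [a = c] is zero in every summand that still ends with [c]; deleting [c]
itself leaves the defect [build (rcons x c)], which removes one of the q - 1
copies obtained by deleting [a].  The other q - 2 copies give the increment of
the factor from one length to the next. *)
Lemma build_sum_rcons x :
  \sum_(a <- S) build (rcons x a) =
  ((size x)%:R * ((size S)%:R - 2) + (size S)%:R) * build x.
Proof.
have [n] := ubnP (size x); elim: n x => // n IH x le_xn.
have [px|npx] := boolP (proper x); last first.
  rewrite (build_improper npx) mulr0 big1 // => a _; apply: build_improper.
  by apply: contra npx; rewrite -cats1; exact: proper_catl.
case: (lastP x) px le_xn => [_ _|{}x c px le_xn].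
  rewrite mul0r add0r build_nil mulr1 -sum1_size natr_sum.
  apply: eq_big_seq => a aS; rewrite build_proper //= ?big_seq1 //.
  by rewrite /proper /= aS.
have cS := proper_rcons_mem px.
transitivity (\sum_(a <- S)
   (\sum_(z <- deletions (rcons x c)) build (rcons z a) + build (rcons x c))
      *+ (a != c)).
  apply: eq_big_seq => a aS; rewrite buildE -?size_eq0 ?size_rcons //.
  rewrite deletions_rcons big_cat big_map big_seq1 /=; congr (_ *+ _).
  rewrite -[rcons _ a]cats1 proper_cat px /proper /= aS /= eq_sym.
  by case: (a != c).
rewrite sum_except // big_split /= exchange_big /=.
rewrite big_const_seq count_predT iter_addr_0.
rewrite deletions_rcons !big_cat !big_map !big_seq1 /=.
rewrite [X in _ - (X + _ + _)]big1 ?add0r; last first.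
  by move=> z _; rewrite -cats1 cat_rcons build_repeat.
rewrite [build (rcons x c)]build_proper -?size_eq0 ?size_rcons //.
rewrite deletions_rcons !big_cat !big_map !big_seq1 /=.
have -> : \sum_(z <- deletions x) \sum_(a <- S) build (rcons (rcons z c) a) =
  \sum_(z <- deletions x)
    ((size x)%:R * ((size S)%:R - 2) + (size S)%:R) * build (rcons z c).
  apply: eq_big_seq => z /size_deletions zx.
  by rewrite IH size_rcons zx // -ltnS -(size_rcons x c).
rewrite IH; last by rewrite -ltnS -(size_rcons x c).
rewrite -mulr_sumr -[_ *+ size S]mulr_natr -natr1.
set A := \sum_(i <- deletions x) _; set s := (size S)%:R.
ring.
Qed.

Lemma build_sum_cons x :
  \sum_(a <- S) build (a :: x) =
  ((size x)%:R * ((size S)%:R - 2) + (size S)%:R) * build x.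
Proof.
rewrite -(build_rev x) -(size_rev x) -build_sum_rcons.
by apply: eq_bigr => a _; rewrite -build_rev rev_cons.
Qed.

Lemma big_deletions_mid (F : seq T -> R) x a y :
  \sum_(z <- deletions (x ++ a :: y)) F z =
  \sum_(z <- deletions x) F (z ++ a :: y) + F (x ++ y)
    + \sum_(z <- deletions y) F (x ++ a :: z).
Proof.
rewrite deletions_cat big_cat big_map [deletions (a :: y)]/= map_cons big_cons.
by rewrite -map_comp big_map /= addrA.
Qed.

(** Deleting a letter of the left word and then filling the gap without
restriction overcounts only when the deleted letter is the last one, [c], and
the gap is filled by [c] again, that is, by the words counted by
[build (rcons x c ++ d :: y)]. *)
Lemma sum_deletions_left x c d y : c \in S -> d \in S ->
  \sum_(a <- S) (\sum_(z <- deletions (rcons x c)) build (z ++ a :: d :: y))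
      *+ ((a != c) && (a != d)) =
  \sum_(z <- deletions (rcons x c)) \sum_(a <- S) build (z ++ a :: d :: y)
    - build (rcons x c ++ d :: y).
Proof.
move=> cS dS; rewrite sum_except2 // exchange_big /=.
rewrite [X in _ - _ - X *+ _]big1 ?mul0rn ?subr0 => [|z _]; last first.
  by rewrite build_repeat.
congr (_ - _); rewrite deletions_rcons big_cat big_map big_seq1 /= cat_rcons.
by rewrite big1 ?add0r // => z _; rewrite cat_rcons build_repeat.
Qed.

(** Mirror image of [sum_deletions_left]. *)
Lemma sum_deletions_right x c d y : c \in S -> d \in S ->
  \sum_(a <- S) (\sum_(z <- deletions (d :: y)) build (rcons x c ++ a :: z))
      *+ ((a != c) && (a != d)) =
  \sum_(z <- deletions (d :: y)) \sum_(a <- S) build (rcons x c ++ a :: z)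
    - build (rcons x c ++ d :: y).
Proof.
move=> cS dS; rewrite sum_except2 // exchange_big /=.
rewrite [X in _ - X - _]big1 ?subr0 => [|z _]; last first.
  by rewrite cat_rcons build_repeat.
congr (_ - _); rewrite big_cons big_map big1 ?addr0 => [|z _]; last first.
  by rewrite build_repeat.
by have [->|] := eqVneq c d; rewrite ?mulr1n // cat_rcons build_repeat mul0rn.
Qed.

Lemma sum_gap1_improper x y : ~~ (proper x && proper y) ->
  \sum_(a <- S) build (x ++ a :: y) = 0.
Proof.
move=> nxy; apply: big1 => a _; apply: build_improper; apply: contra nxy => p.
by rewrite (proper_catl p) /=; move: p; rewrite -cat_rcons; exact: proper_catr.
Qed.

(** When [c != d], the gap letter has two admissible values, so deleting it
contributes twice [build (rcons x c ++ d :: y)]; this is exactly what the two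
sides lose by [sum_deletions_left] and [sum_deletions_right].  When [c = d],
all these terms vanish.  What is left is Pascal's rule. *)
Lemma build_gap1 x y : size S = 4 ->
  \sum_(a <- S) build (x ++ a :: y) =
  (2 * 'C(size x + size y + 2, size x + 1))%:R * build x * build y.
Proof.
move=> S4.
have [n] := ubnP (size x + size y); elim: n x y => // n IH x y le_n.
have [/andP[px py]|npxy] := boolP (proper x && proper y); last first.
  rewrite sum_gap1_improper //.
  by case/nandP: npxy => /build_improper ->; rewrite ?mulr0 ?mul0r.
case: (lastP x) px le_n => [_ _|{}x c px].
  rewrite build_sum_cons S4 build_nil mulr1 add0n bin1 natrM natrD; ring.
case: y py => [_ _|d y py le_n].
  under eq_bigr do rewrite cats1.
  rewrite build_sum_rcons S4 build_nil mulr1 addn0 addn2 addn1 binSn.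
  by rewrite natrM -[_.+2]addn2 natrD; ring.
have cS := proper_rcons_mem px.
have dS : d \in S := @proper_mem [::] d y py.
transitivity (\sum_(a <- S)
   (\sum_(z <- deletions (rcons x c)) build (z ++ a :: d :: y)
    + build (rcons x c ++ d :: y)
    + \sum_(z <- deletions (d :: y)) build (rcons x c ++ a :: z))
      *+ ((a != c) && (a != d))).
  apply: eq_big_seq => a aS.
  rewrite buildE; last by rewrite -size_eq0 size_cat addnS.
  have -> : proper (rcons x c ++ [:: a, d & y]) = (a != c) && (a != d).
    by rewrite proper_cat px proper_cons aS py /= !andbT andbC eq_sym.
  by rewrite big_deletions_mid.
under eq_bigr do rewrite !mulrnDl.
rewrite !big_split /= sum_deletions_left // sum_deletions_right //.
rewrite (sum_except2 (fun=> build _)) //.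
rewrite big_const_seq count_predT iter_addr_0 S4.
have -> : build (rcons x c ++ d :: y) *+ (c != d) = build (rcons x c ++ d :: y).
  by have [->|//] := eqVneq c d; rewrite cat_rcons build_repeat mul0rn.
have IHl z : z \in deletions (rcons x c) ->
  \sum_(a <- S) build (z ++ a :: d :: y) =
  (2 * 'C(size x + size (d :: y) + 2, size x + 1))%:R * build z * build (d :: y).
  move=> /size_deletions; rewrite size_rcons => -[zx].
  by rewrite IH ?zx // -ltnS -addSn -(size_rcons x c).
have IHr z : z \in deletions (d :: y) ->
  \sum_(a <- S) build (rcons x c ++ a :: z) =
  (2 * 'C(size (rcons x c) + size y + 2, size (rcons x c) + 1))%:R
    * build (rcons x c) * build z.
  move=> /size_deletions [zy].
  by rewrite IH ?zy // -ltnS -addnS.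
rewrite (eq_big_seq _ IHl) (eq_big_seq _ IHr) -!mulr_sumr -mulr_suml -mulr_sumr.
rewrite -build_proper // -?build_proper -?size_eq0 ?size_rcons //.
have -> : ((size x).+1 + size (d :: y) + 2 = (size x + size (d :: y) + 2).+1)%N by [].
have -> : ((size x).+1 + 1 = (size x + 1).+1)%N by [].
rewrite binS /= !addnS !addSn !natrM natrD.
set B := build _; ring.
Qed.

(** With three letters, once [c] and [b] are distinct there is a single
admissible [a].  Hence deleting [a] contributes one copy of
[build (rcons x c ++ b :: y)], which cancels the defect of
[sum_deletions_left]. *)
Lemma sum_gap2_left x c b y : size S = 3 -> c \in S -> b \in S ->
  \sum_(a <- S)
    (\sum_(z <- deletions (rcons x c)) build (z ++ [:: a, b & y])
     + build (rcons x c ++ b :: y)) *+ ((a != c) && (a != b)) =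
  \sum_(z <- deletions (rcons x c)) \sum_(a <- S) build (z ++ [:: a, b & y]).
Proof.
move=> S3 cS bS; under eq_bigr do rewrite mulrnDl.
rewrite big_split /= sum_deletions_left // (sum_except2 (fun=> build _)) //.
rewrite big_const_seq count_predT iter_addr_0 S3.
have -> : build (rcons x c ++ b :: y) *+ (c != b) = build (rcons x c ++ b :: y).
  by have [->|//] := eqVneq c b; rewrite cat_rcons build_repeat mul0rn.
ring.
Qed.

Lemma sum_gap2_right x a d y : size S = 3 -> a \in S -> d \in S ->
  \sum_(b <- S)
    (build (rcons x a ++ d :: y) +
     \sum_(z <- deletions (d :: y)) build (rcons x a ++ b :: z))
      *+ ((b != a) && (b != d)) =
  \sum_(z <- deletions (d :: y)) \sum_(b <- S) build (rcons x a ++ b :: z).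
Proof.
move=> S3 aS dS; under eq_bigr do rewrite mulrnDl.
rewrite big_split /= sum_deletions_right // (sum_except2 (fun=> build _)) //.
rewrite big_const_seq count_predT iter_addr_0 S3.
have -> : build (rcons x a ++ d :: y) *+ (a != d) = build (rcons x a ++ d :: y).
  by have [->|//] := eqVneq a d; rewrite cat_rcons build_repeat mul0rn.
ring.
Qed.

(** Deletions in [x], together with the deletion of [a], are summed over [a]
first; deletions in [y], together with the deletion of [b], are summed over
[b] first.  By [sum_gap2_left] and [sum_gap2_right] each half is an
unrestricted sum, and Pascal's rule concludes as in [build_gap1]. *)
Lemma build_gap2 x y : size S = 3 ->
  \sum_(a <- S) \sum_(b <- S) build (x ++ [:: a, b & y]) =
  (2 * 'C(size x + size y + 4, size x + 2))%:R * build x * build y.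
Proof.
move=> S3.
have [n] := ubnP (size x + size y); elim: n x y => // n IH x y le_n.
have [/andP[px py]|npxy] := boolP (proper x && proper y); last first.
  rewrite big1 => [|a _]; last first.
    apply: big1 => b _; apply: build_improper; apply: contra npxy => p.
    by rewrite (proper_catl p) /=; move: p; rewrite -2!cat_rcons; exact: proper_catr.
  by case/nandP: npxy => /build_improper ->; rewrite ?mulr0 ?mul0r.
case: (lastP x) px le_n => [_ _|{}x c px].
  rewrite exchange_big /=; under eq_bigr do rewrite build_sum_cons /=.
  rewrite -mulr_sumr build_sum_cons S3 build_nil mulr1 add0n add0n.
  (* 2 C(n+4, 2) is computed as (n + 4) C(n+3, 1). *)
  rewrite -(mul_bin_diag _ 1) bin1 !addnS addn0 /= mulrA; congr (_ * _).
  by rewrite natrM -!natr1; ring.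
case: y py => [_ _|d y py le_n].
  under eq_bigr do under eq_bigr do rewrite -cat_rcons cats1.
  under eq_bigr do rewrite build_sum_rcons size_rcons.
  rewrite -mulr_sumr build_sum_rcons S3 build_nil mulr1 addn0.
  set m := size _; rewrite (_ : m + 2 = m + 4 - 2)%N; last by rewrite -addnBA.
  rewrite bin_sub ?addn4 // -(mul_bin_diag _ 1) bin1 /= mulrA; congr (_ * _).
  by rewrite natrM -!natr1; ring.
have cS := proper_rcons_mem px.
have dS : d \in S := @proper_mem [::] d y py.
pose x' := rcons x c; pose y' := d :: y.
transitivity (\sum_(a <- S) \sum_(b <- S)
   (((\sum_(z <- deletions x') build (z ++ [:: a, b & y']) + build (x' ++ b :: y'))
      *+ ((a != c) && (a != b))) *+ (b != d)
   + ((build (rcons x' a ++ y')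
        + \sum_(z <- deletions y') build (rcons x' a ++ b :: z))
      *+ ((b != a) && (b != d))) *+ (a != c))).
  apply: eq_big_seq => a aS; apply: eq_big_seq => b bS.
  rewrite buildE; last by rewrite -size_eq0 size_cat addnS.
  have -> : proper (x' ++ [:: a, b & y']) = [&& a != c, a != b & b != d].
    rewrite proper_cat px !proper_cons aS bS py /= !andbT [c == a]eq_sym.
    by case: (a != c); case: (a != b); case: (b != d).
  rewrite big_deletions_mid big_cons big_map -!cat_rcons.
  rewrite -!mulrnA !mulnb [b == a]eq_sym [_ && (a != c)]andbC -andbA -mulrnDl.
  congr (_ *+ _); rewrite !addrA; congr (_ + _ + _).
  by apply: eq_bigr => z _; rewrite [in RHS]cat_rcons.
under eq_bigr do rewrite big_split; rewrite big_split /=.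
rewrite exchange_big /=.
have -> : \sum_(b <- S) \sum_(a <- S)
   ((\sum_(z <- deletions x') build (z ++ [:: a, b & y']) + build (x' ++ b :: y'))
      *+ ((a != c) && (a != b))) *+ (b != d) =
   \sum_(z <- deletions x')
     (2 * 'C(size x + size y' + 4, size x + 2))%:R * build z * build y'.
  transitivity (\sum_(b <- S) \sum_(z <- deletions x') \sum_(a <- S)
                   build (z ++ [:: a, b & y'])).
    apply: eq_big_seq => b bS; rewrite sumrMnl sum_gap2_left //.
    have [->|//] := eqVneq b d; rewrite mulr0n big1 // => z _.
    by apply: big1 => a _; rewrite -cat_rcons build_repeat.
  rewrite exchange_big; apply: eq_big_seq => z zx; rewrite exchange_big /=.
  have [zs] : (size z).+1 = (size x).+1 by rewrite (size_deletions zx) size_rcons.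
  by rewrite IH ?zs // -ltnS -addSn -(size_rcons x c).
have -> : \sum_(a <- S) \sum_(b <- S)
   ((build (rcons x' a ++ y')
        + \sum_(z <- deletions y') build (rcons x' a ++ b :: z))
      *+ ((b != a) && (b != d))) *+ (a != c) =
   \sum_(z <- deletions y')
     (2 * 'C(size x' + size y + 4, size x' + 2))%:R * build x' * build z.
  transitivity (\sum_(a <- S) \sum_(z <- deletions y') \sum_(b <- S)
                   build (rcons x' a ++ b :: z)).
    apply: eq_big_seq => a aS; rewrite sumrMnl sum_gap2_right //.
    have [->|//] := eqVneq a c; rewrite mulr0n big1 // => z _.
    by apply: big1 => b _; rewrite !cat_rcons build_repeat.
  rewrite exchange_big; apply: eq_big_seq => z zy.
  have [zs] : (size z).+1 = (size y).+1 by rewrite (size_deletions zy).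
  under eq_bigr do under eq_bigr do rewrite cat_rcons.
  by rewrite IH ?zs // -ltnS -addnS.
rewrite -mulr_suml -!mulr_sumr -!build_proper -?size_eq0 ?size_rcons //.
rewrite -/x' -/y' !addSn addnS [in RHS]binS !natrM natrD /=.
rewrite !addnS !addSn.
set B := build _; ring.
Qed.

End Buildings.

(** * Consistent block laws from building numbers *)

Record block_law (R : numDomainType) (T : eqType) (S : seq T) (p : seq T -> R) :
    Prop := BlockLaw {
  block_ge0 : forall x, 0 <= p x;
  block_out : forall x, ~~ all (mem S) x -> p x = 0;
  block_nil : p [::] = 1;
  block_sum_rcons : forall x, \sum_(a <- S) p (rcons x a) = p x;
  block_sum_cons : forall x, \sum_(a <- S) p (a :: x) = p x }.

Section Weights.
Variables (R : numFieldType) (T : eqType) (S : seq T).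
Hypothesis uniqS : uniq S.
Implicit Types x y : seq T.
Local Notation build := (build S R).

Definition weight4 x : R := build x / (2 ^+ size x * (size x).+1`!%:R).
Definition weight3 x : R := 2 * build x / (size x).+2`!%:R.

Let fact_neq0 n : n`!%:R != 0 :> R.
Proof. by rewrite pnatr_eq0 -lt0n fact_gt0. Qed.

Let natr_neq0 n : n.+1%:R != 0 :> R.
Proof. by rewrite pnatr_eq0. Qed.

Lemma weight4_block_law : size S = 4 -> block_law S weight4.
Proof.
move=> S4; have step n (b : R) :
  (n%:R * (4%:R - 2) + 4%:R) * b / (2 ^+ n.+1 * n.+2`!%:R) =
  b / (2 ^+ n * n.+1`!%:R).
  rewrite exprS factS natrM.
  have -> : n%:R * (4%:R - 2) + 4%:R = 2 * n.+2%:R :> R by rewrite -!natr1; ring.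
  move: n.+2%:R n.+1`!%:R (natr_neq0 n.+1) (fact_neq0 n.+1) => k f k0 f0.
  by field; rewrite k0 f0 expf_neq0 ?pnatr_eq0.
split=> [x|x nx||x|x].
- by rewrite divr_ge0 ?build_ge0 // mulr_ge0 ?exprn_ge0 ?ler0n.
- by rewrite /weight4 build_improper ?mul0r // /proper (negbTE nx).
- by rewrite /weight4 build_nil expr0 !mul1r invr1.
- under eq_bigr do rewrite /weight4 size_rcons.
  by rewrite -mulr_suml build_sum_rcons // S4 step.
- by rewrite /weight4 /= -mulr_suml build_sum_cons // S4 step.
Qed.

Lemma weight3_block_law : size S = 3 -> block_law S weight3.
Proof.
move=> S3; have step n (b : R) :
  2 * ((n%:R * (3%:R - 2) + 3%:R) * b) / n.+3`!%:R = 2 * b / n.+2`!%:R.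
  rewrite [n.+3`!]factS natrM.
  have -> : n%:R * (3%:R - 2) + 3%:R = n.+3%:R :> R by rewrite -!natr1; ring.
  move: n.+3%:R n.+2`!%:R (natr_neq0 n.+2) (fact_neq0 n.+2) => k f k0 f0.
  by field; rewrite k0 f0.
split=> [x|x nx||x|x].
- by rewrite divr_ge0 ?mulr_ge0 ?build_ge0 ?ler0n.
- by rewrite /weight3 build_improper ?mulr0 ?mul0r // /proper (negbTE nx).
- by rewrite /weight3 build_nil mulr1 divff // pnatr_eq0.
- under eq_bigr do rewrite /weight3 size_rcons.
  by rewrite -mulr_suml -mulr_sumr build_sum_rcons // S3 step.
- by rewrite /weight3 /= -mulr_suml -mulr_sumr build_sum_cons // S3 step.
Qed.

Let binomial_fact m n :
  'C(m + n, m)%:R * m`!%:R * n`!%:R = (m + n)`!%:R :> R.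
Proof. by rewrite -!natrM -mulnA -{2}[n](addKn m) bin_fact // leq_addr. Qed.

(** The constant of [build_gap1] is the ratio of the normalizing factors of
the two sides. *)
Lemma weight4_gap x y : size S = 4 ->
  \sum_(a <- S) weight4 (x ++ a :: y) = weight4 x * weight4 y.
Proof.
move=> S4; rewrite /weight4; under eq_bigr do rewrite size_cat /=.
rewrite -mulr_suml build_gap1 //.
move: (size x) (size y) (build x) (build y) => m n b c.
have -> : (m + n + 2 = m.+1 + n.+1)%N by lia.
have -> : ((m + n.+1).+1 = m.+1 + n.+1)%N by lia.
have := fact_neq0 (m.+1 + n.+1).
rewrite addn1 -binomial_fact natrM exprD exprS.
move: 'C(_, _)%:R m.+1`!%:R n.+1`!%:R (fact_neq0 m.+1) (fact_neq0 n.+1).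
move=> C f g f0 g0; rewrite mulf_eq0 mulf_eq0 !negb_or => /andP[/andP[C0 _] _].
by field; rewrite f0 g0 C0 !expf_neq0 ?pnatr_eq0.
Qed.

Lemma weight3_gap x y : size S = 3 ->
  \sum_(a <- S) \sum_(b <- S) weight3 (x ++ [:: a, b & y]) =
  weight3 x * weight3 y.
Proof.
move=> S3; rewrite /weight3; under eq_bigr do under eq_bigr do rewrite size_cat /=.
under eq_bigr do rewrite -mulr_suml -mulr_sumr.
rewrite -mulr_suml -mulr_sumr build_gap2 //.
move: (size x) (size y) (build x) (build y) => m n b c.
have -> : (m + n + 4 = m.+2 + n.+2)%N by lia.
have -> : ((m + n.+2).+2 = m.+2 + n.+2)%N by lia.
have := fact_neq0 (m.+2 + n.+2).
rewrite addn2 -binomial_fact natrM.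
move: 'C(_, _)%:R m.+2`!%:R n.+2`!%:R (fact_neq0 m.+2) (fact_neq0 n.+2).
move=> C f g f0 g0; rewrite mulf_eq0 mulf_eq0 !negb_or => /andP[/andP[C0 _] _].
by field; rewrite f0 g0 C0.
Qed.

Lemma weight4_repeat a : weight4 [:: a; a] = 0.
Proof. by rewrite /weight4 (build_repeat _ _ [::]) mul0r. Qed.

Lemma weight3_repeat a : weight3 [:: a; a] = 0.
Proof. by rewrite /weight3 (build_repeat _ _ [::]) mulr0 mul0r. Qed.

End Weights.

(** * Families of discrete random variables are determined by cylinders *)

Section Cylinders.
Variables (I : eqType) (W : nat -> seq I).
Hypothesis W_mono : forall m n, (m <= n)%N -> {subset W m <= W n}.
Hypothesis W_cover : forall i, exists n, i \in W n.
Hypothesis W0 : W 0 = [::].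

Local Notation product_sigma := (@product_sigma_algebra I _ nat).

Definition cylinder n (w : seq nat) : set (I -> nat) :=
  [set x : I -> nat | map x (W n) = w].

Definition cylinders : set (set (I -> nat)) :=
  [set A | A = set0 \/ exists n w, A = cylinder n w].

(** Two cylinders over nested windows are either disjoint or nested. *)
Lemma cylinders_setI : setI_closed cylinders.
Proof.
suff meet m n v w : (m <= n)%N ->
    cylinder m v `&` cylinder n w = set0 \/
    cylinder m v `&` cylinder n w = cylinder n w.
  move=> _ _ [->|[m [v ->]]] [->|[n [w ->]]].
  - by left; rewrite set0I.
  - by left; rewrite set0I.
  - by left; rewrite setI0.
  case: (leqP m n) => [mn|/ltnW nm].
    by case: (meet m n v w mn) => ->; [left|right; exists n, w].
  by rewrite setIC; case: (meet n m w v nm) => ->; [left|right; exists m, v].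
move=> mn.
have [->|/set0P[x [xm xn]]] := eqVneq (cylinder m v `&` cylinder n w) set0.
  by left.
right; apply/seteqP; split=> [y []//|y yn]; split=> //.
rewrite /cylinder /= -xm; apply/eq_in_map => i /(W_mono mn).
by move: (etrans yn (esym xn)) => /eq_in_map; apply.
Qed.

(** A coordinate event is the union of the cylinders over a window that
contains the coordinate, and there are only countably many words. *)
Lemma product_sigma_algebra_cylinders :
  product_sigma `<=` <<s cylinders >>.
Proof.
apply: smallest_sub; first exact: smallest_sigma_algebra.
move=> _ [i _ [B _ <-]].
have [n iW] := W_cover i.
pose C (o : option (seq nat)) := if o is Some w then
  if nth 0%N w (index i (W n)) \in (B : set nat) then cylinder n w else set0
  else set0.
have CC o : cylinders (C o).
  case: o => [w|] /=; last by left.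
  by case: ifP => _; [right; exists n, w|left].
rewrite setTI [X in <<s _ >> X](_ : _ = \bigcup_k C (unpickle k)).
  by apply: sigma_algebra_bigcup => k; apply: sub_sigma_algebra; exact: CC.
apply/seteqP; split=> [x Bx|x [k _]].
  exists (pickle (map x (W n))) => //.
  rewrite /C pickleK (nth_map i) ?index_mem // nth_index // ifT //.
  exact/mem_set.
case: (unpickle k) => //= w; case: ifP => // /set_mem + xw; rewrite -xw.
by rewrite (nth_map i) ?index_mem // nth_index.
Qed.

Context {d : measure_display} {T : measurableType d} {R : realType}.

Lemma measurable_family_event (Y : I -> {mfun T >-> nat}) A :
  product_sigma A -> measurable [set w | A (fun i => Y i w)].
Proof.
move: A; apply: smallest_sub.
  split=> [|A mA|A mA].
  - exact: measurable0.
  - rewrite setTD; exact: measurableC.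
  - exact: bigcupT_measurable.
move=> _ [i _ [B mB <-]]; rewrite setTI.
exact: (measurable_funPTI (Y i)).
Qed.

Lemma measurable_map_event (Y : I -> {mfun T >-> nat}) (s : seq I) w :
  measurable [set t | [seq Y i t | i <- s] = w].
Proof.
elim: s w => [|i s IH] [|a w].
- by rewrite (_ : mkset _ = setT) ?predeqE.
- by rewrite (_ : mkset _ = set0) ?predeqE.
- by rewrite (_ : mkset _ = set0) ?predeqE.
rewrite (_ : mkset _ = Y i @^-1` [set a] `&` [set t | [seq Y i t | i <- s] = w]).
  apply: measurableI => //.
  exact: measurable_funPTI.
by apply/seteqP; split=> t /= [-> ->].
Qed.

(** The two measures may differ: [m1] will be [P] restricted to an event
and [m2] a multiple of [P] when independence is proved. *)
Lemma measure_family_unique (m1 m2 : {measure set T -> \bar R})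
    (Y Z : I -> {mfun T >-> nat}) :
  (m1 [set: T] < +oo)%E ->
  (forall n w, m1 [set t | cylinder n w (fun i => Y i t)] =
               m2 [set t | cylinder n w (fun i => Z i t)]) ->
  forall A, product_sigma_algebra A ->
  m1 [set t | A (fun i => Y i t)] = m2 [set t | A (fun i => Z i t)].
Proof.
move=> m1oo m12 A pA.
pose H := [set A | [/\ measurable [set t | A (fun i => Y i t)],
  measurable [set t | A (fun i => Z i t)] &
  m1 [set t | A (fun i => Y i t)] = m2 [set t | A (fun i => Z i t)]]].
suff /(_ A pA) [] : product_sigma `<=` H by [].
have m12T : m1 setT = m2 setT.
  have cylT V : [set t | cylinder 0 [::] (fun i => V i t)] = [set: T].
    by rewrite /cylinder W0; apply/seteqP; split.
  by have := m12 0%N [::]; rewrite !cylT.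
apply: (subset_trans product_sigma_algebra_cylinders).
apply: lambda_system_subset => //; first exact: cylinders_setI.
  apply/dynkin_lambda_system; split.
  - by split; try exact: measurableT; exact: m12T.
  - move=> B [mY mZ m12B]; split; try exact: measurableC.
    rewrite -[X in m1 X](setTD [set t | B (fun i => Y i t)]).
    rewrite -[X in m2 X](setTD [set t | B (fun i => Z i t)]).
    rewrite !measureD ?setTI //; last by rewrite [ltLHS](esym m12T).
    by congr (_ - _)%E; [exact: m12T|exact: m12B].
  - move=> F tF HF; split.
    + by apply: bigcupT_measurable => k; case: (HF k).
    + by apply: bigcupT_measurable => k; case: (HF k).
    + have disj (V : I -> {mfun T >-> nat}) :
          trivIset setT (fun k => [set t | F k (fun i => V i t)]).
        apply/trivIsetP => i j _ _ ij; apply/seteqP; split=> // t [Fi Fj].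
        have /trivIsetP/(_ i j Logic.I Logic.I ij) := tF.
        by move=> /seteqP[/(_ _ (conj Fi Fj))].
      have bigE (V : I -> {mfun T >-> nat}) :
          [set t | (\bigcup_k F k) (fun i => V i t)] =
          \bigcup_k [set t | F k (fun i => V i t)] by [].
      rewrite !bigE !measure_bigcup //; try by move=> k _; case: (HF k).
      by apply: eq_eseriesr => k _; case: (HF k).
move=> _ [->|[n [w ->]]].
  have e0 (V : I -> {mfun T >-> nat}) :
    [set t | set0 (fun i => V i t)] = set0 :> set T by [].
  by split; rewrite ?e0 ?measure0 //; exact: measurable0.
by split; try exact: measurable_map_event.
Qed.
End Cylinders.

(** * Reduction of stationarity and independence to finite blocks *)

Section Reductions.
Context {d : measure_display} {T : measurableType d} {R : realType}
  {P : probability T R}.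

Lemma independent_of_event (Y : nat -> {RV P >-> nat}) (D : set T) :
  measurable D ->
  (forall n w, P ([set t | [seq Y i t | i <- iota 0 n] = w] `&` D) =
    P [set t | [seq Y i t | i <- iota 0 n] = w] * P D)%E ->
  forall A, product_sigma_algebra A ->
    (P (family_event Y A `&` D) = P (family_event Y A) * P D)%E.
Proof.
move=> mD YD A pA.
have PD : (fine (P D))%:E = P D by rewrite fineK // fin_num_measure.
have PD0 : 0 <= fine (P D) by rewrite fine_ge0.
pose m2 := mscale (NngNum PD0) P.
have m2E B : m2 B = (P B * P D)%E by rewrite /m2 /mscale /= PD muleC.
rewrite -m2E -/(mrestr P mD _).
apply: (@measure_family_unique _ (iota 0)) => //.
- by move=> m n mn i; rewrite !mem_iota /= !add0n => /leq_trans; apply.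
- by move=> i; exists i.+1; rewrite mem_iota /= add0n.
- by rewrite /= /mrestr setTI -PD ltry.
- by move=> n w; rewrite [RHS]m2E; exact: YD.
Qed.

(** The pi-lambda theorem is applied to one family at a time: first to [Y],
with a block of [Z] fixed, and then to [Z], with an arbitrary event of [Y]
fixed; the proof reads backwards. *)
Lemma independent_of_blocks (Y Z : nat -> {RV P >-> nat}) :
  (forall m n u v,
    P ([set t | [seq Y i t | i <- iota 0 m] = u] `&`
       [set t | [seq Z i t | i <- iota 0 n] = v]) =
    P [set t | [seq Y i t | i <- iota 0 m] = u] *
    P [set t | [seq Z i t | i <- iota 0 n] = v])%E ->
  independent_families Y Z.
Proof.
move=> YZ A B pA pB.
rewrite setIC [RHS]muleC; apply: independent_of_event => // [|n v].
  exact: measurable_family_event.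
rewrite setIC [RHS]muleC; apply: independent_of_event => //.
exact: measurable_map_event.
Qed.

Definition block (X : int -> {RV P >-> nat}) (i : int) (n : nat) (t : T) :=
  [seq X (i + j%:Z) t | j <- iota 0 n].

Lemma equal_in_law_of_blocks (X Y : int -> {RV P >-> nat}) :
  (forall i n w, P [set t | block X i n t = w] = P [set t | block Y i n t = w]) ->
  equal_in_law X Y.
Proof.
move=> XY A pA.
pose W n : seq int := [seq - n%:Z + j%:Z | j <- iota 0 n.*2].
have memW n i : (i \in W n) = (- n%:Z <= i < n%:Z).
  apply/mapP/idP => [[j]|ni].
    by rewrite mem_iota add0n /= => jn ->; lia.
  by exists (absz (i + n%:Z)%R); [rewrite mem_iota; lia|lia].
apply: (@measure_family_unique _ W) => //.
- by move=> m n mn i; rewrite !memW; lia.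
- by move=> i; exists (absz i).+1; rewrite memW; lia.
- by rewrite [ltLHS](probability_setT P) ltry.
- move=> n w.
  have E (V : int -> {RV P >-> nat}) :
      [set t | cylinder W n w (fun i => V i t)] =
      [set t | block V (- n%:Z) n.*2 t = w].
    by apply/eq_set => t; rewrite /cylinder /block /W /= -map_comp.
  by rewrite !E; exact: XY.
Qed.

End Reductions.

(** * Random letters from nested subintervals of the unit interval *)

Section UnitInterval.
Variable R : realType.

Definition unit_uniform : set (measurableTypeR R) -> \bar R :=
  mrestr (@lebesgue_measure R) (measurable_itv `[0, 1[).

HB.instance Definition _ := Measure.on unit_uniform.

Let unit_uniform_setT : unit_uniform setT = 1%:E.
Proof.
by rewrite /unit_uniform /mrestr setTI lebesgue_measure_itv /= lte01 sube0.
Qed.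

HB.instance Definition _ :=
  Measure_isProbability.Build _ _ R unit_uniform unit_uniform_setT.

End UnitInterval.

Section NestedIntervals.
Variables (R : realType) (q : nat) (f : seq nat -> R).
Hypothesis q_gt0 : (0 < q)%N.
Hypothesis f_ge0 : forall u, 0 <= f u.
Hypothesis f_nil : f [::] = 1.
Hypothesis f_cons : forall u, \sum_(a <- iota 1 q) f (a :: u) = f u.
Implicit Types (a b : nat) (u : seq nat) (t : R).

(** A word lists the letters drawn so far, the most recent one first.  The
children of the slot of [u] cut it from left to right, in the order of the new
letter, into intervals of lengths [f (a :: u)]. *)
Fixpoint lower u : R :=
  if u is a :: v then lower v + \sum_(c <- iota 1 a.-1) f (c :: v) else 0.

Definition in_slot u t := lower u <= t < lower u + f u.

(** The default value only matters for [t] outside [0,1[; choosing a letter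
keeps every history in the alphabet, for every [t]. *)
Definition next_letter u t := head 1%N [seq a <- iota 1 q | in_slot (a :: u) t].

Fixpoint history n t : seq nat :=
  if n is m.+1 then next_letter (history m t) t :: history m t else [::].

Let upper_cons a u : (0 < a)%N ->
  lower (a :: u) + f (a :: u) = lower u + \sum_(c <- iota 1 a) f (c :: u).
Proof.
case: a => // a _.
have -> : iota 1 a.+1 = rcons (iota 1 a) a.+1.
  by rewrite -cats1 -(addn1 a) iotaD addn1 add1n.
by rewrite /= -cats1 big_cat big_seq1 /= addrA.
Qed.

Let partial_mono u m n : (m <= n)%N ->
  \sum_(c <- iota 1 m) f (c :: u) <= \sum_(c <- iota 1 n) f (c :: u).
Proof.
move=> /subnKC <-; rewrite iotaD big_cat /= lerDl.
by apply: sumr_ge0 => c _; exact: f_ge0.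
Qed.

Lemma in_slot_cons a u t : a \in iota 1 q -> in_slot (a :: u) t -> in_slot u t.
Proof.
rewrite mem_iota add1n ltnS => /andP[a1 aq] /andP[lo hi]; apply/andP; split.
  by apply: le_trans lo; rewrite lerDl sumr_ge0.
apply: lt_le_trans hi _; rewrite upper_cons // lerD2l -[leRHS]f_cons.
exact: partial_mono.
Qed.

Lemma in_slot_child u t : in_slot u t ->
  exists2 a, a \in iota 1 q & in_slot (a :: u) t.
Proof.
rewrite /in_slot => /andP[lo]; rewrite -f_cons.
elim: {1 3}q (leqnn q) => [|m IH] mq; first by rewrite /= big_nil addr0 ltNge lo.
move=> hi; have [/(IH (ltnW mq))//|ge] :=
  ltP t (lower u + \sum_(c <- iota 1 m) f (c :: u)).
exists m.+1; first by rewrite mem_iota /= add1n ltnS.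
by rewrite upper_cons // ge hi.
Qed.

Lemma in_slot_inj u t a b : a \in iota 1 q -> b \in iota 1 q ->
  in_slot (a :: u) t -> in_slot (b :: u) t -> a = b.
Proof.
wlog ab : a b / (a < b)%N => [sym|].
  case: (ltngtP a b) => [ab|ba|//] aq bq ta tb; first exact: sym ab aq bq ta tb.
  by apply/esym; exact: sym ba bq aq tb ta.
rewrite !mem_iota => /andP[a1 _] _ /andP[_ hi] /andP[lo _].
suff /(lt_le_trans hi)/lt_le_trans/(_ lo) : 
  lower (a :: u) + f (a :: u) <= lower (b :: u) by rewrite ltxx.
by rewrite upper_cons //= lerD2l partial_mono // -ltnS (ltn_predK ab).
Qed.

Lemma next_letterE u t a : a \in iota 1 q -> in_slot (a :: u) t ->
  next_letter u t = a.
Proof.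
move=> aq ta; rewrite /next_letter.
case E: [seq b <- _ | _] => [|b s].
  by have : a \in [::] by rewrite -E mem_filter ta.
have : b \in [seq b <- iota 1 q | in_slot (b :: u) t] by rewrite E mem_head.
by rewrite mem_filter => /andP[tb bq]; exact: in_slot_inj bq aq tb ta.
Qed.

Lemma next_letter_range u t : next_letter u t \in iota 1 q.
Proof.
rewrite /next_letter; case E: [seq b <- _ | _] => [|b s] /=.
  by rewrite mem_iota /= add1n ltnS.
have : b \in [seq a <- iota 1 q | in_slot (a :: u) t] by rewrite E mem_head.
by rewrite mem_filter => /andP[].
Qed.

Lemma history_range n t : all (mem (iota 1 q)) (history n t).
Proof. by elim: n => //= n ->; rewrite next_letter_range. Qed.

Lemma size_history n t : size (history n t) = n.
Proof. by elim: n => //= n ->. Qed.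

Lemma in_slot_unit u t : all (mem (iota 1 q)) u -> in_slot u t -> 0 <= t < 1.
Proof.
elim: u => [_|a u IH /= /andP[aq uq]].
  by rewrite /in_slot /= f_nil add0r.
by move=> /(in_slot_cons aq); exact: IH.
Qed.

Lemma in_slot_history n t : 0 <= t < 1 -> in_slot (history n t) t.
Proof.
move=> t01; elim: n => [|n IH]; first by rewrite /in_slot /= f_nil add0r.
have [a aq ta] := in_slot_child IH.
by rewrite /= (next_letterE aq ta).
Qed.

Lemma history_in_slot u t : all (mem (iota 1 q)) u -> in_slot u t ->
  history (size u) t = u.
Proof.
elim: u => [//|a u IH] /= /andP[aq uq] tau.
by rewrite (IH uq (in_slot_cons aq tau)) (next_letterE aq tau).
Qed.

(** Outside [0,1[ the history is constant, which makes its events measurable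
on the whole line. *)
Lemma history_out n t : ~~ (0 <= t < 1) -> history n t = nseq n 1%N.
Proof.
move=> t01; elim: n => //= n IH; congr (_ :: _) => //.
rewrite /next_letter (@eq_in_filter _ _ pred0) ?filter_pred0 // => a aq.
apply: contraNF t01; apply: in_slot_unit.
by rewrite /= aq history_range.
Qed.

Local Notation T := (measurableTypeR R).

Lemma history_slot u : all (mem (iota 1 q)) u ->
  [set t : T | history (size u) t = u] `&` `[0, 1[ =
  `[lower u, lower u + f u[%classic.
Proof.
move=> uq; apply/seteqP; split=> t /=.
  rewrite !in_itv /= => -[tu t01].
  by have := in_slot_history (size u) t01; rewrite tu.
rewrite !in_itv /= => tu; split; first exact: history_in_slot.
exact: in_slot_unit tu.
Qed.

Lemma measurable_history_event n u : measurable [set t : T | history n t = u].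
Proof.
have [/andP[/eqP <- uq]|nu] := boolP ((size u == n) && all (mem (iota 1 q)) u);
  last first.
  rewrite (_ : mkset _ = set0) // -subset0 => t /= tu.
  by move: nu; rewrite -tu size_history eqxx history_range.
rewrite -(setUIDK [set t : T | _] (`[0, 1[%classic : set T)) setDE history_slot //.
apply: measurableU; first exact: measurable_itv.
have [->|u1] := eqVneq u (nseq (size u) 1%N).
  rewrite (_ : _ `&` _ = ~` `[0, 1[%classic).
    by apply: measurableC; exact: measurable_itv.
  apply/setIidPr => t /= t01; rewrite size_nseq; apply: history_out.
  by apply/negP; move: t01; rewrite in_itv.
rewrite (_ : _ `&` _ = set0) // -subset0 => t /= [tu]; rewrite in_itv /= => t01.
by move: u1; rewrite -{1}tu history_out ?eqxx //; apply/negP.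
Qed.

Lemma measurable_of_history n (g : seq nat -> nat) :
  measurable_fun [set: T] (g \o history n).
Proof.
move=> _ B _; rewrite setTI.
rewrite (_ : _ @^-1` _ = \bigcup_u
    (if g u \in (B : set nat) then [set t : T | history n t = u] else set0)).
  apply: countable_bigcupT_measurable => // u.
  by case: ifP => // _; exact: measurable_history_event.
apply/seteqP; split=> [t Bt|t [u _]].
  by exists (history n t) => //=; rewrite ifT //; exact/mem_set.
by case: ifP => // /set_mem Bu /= ->.
Qed.

Lemma unit_uniform_history u : all (mem (iota 1 q)) u ->
  unit_uniform [set t : T | history (size u) t = u] = (f u)%:E.
Proof.
move=> uq; rewrite /unit_uniform /mrestr history_slot //.
rewrite lebesgue_measure_itv /= lte_fin ltrDl.
case: ltP => [_|f0]; first by rewrite -EFinB addrAC subrr add0r.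
by congr EFin; apply/le_anti; rewrite f_ge0.
Qed.

End NestedIntervals.

(** * Blocks of consecutive coordinates *)

Section Blocks.
Context {d : measure_display} {T : measurableType d} {R : realType}
  {P : probability T R}.
Implicit Types (X : int -> {RV P >-> nat}) (i : int) (n : nat) (t : T).

Lemma iota_shift m n : iota m n = [seq (m + j)%N | j <- iota 0 n].
Proof. by rewrite -iotaDl addn0. Qed.

Lemma size_block X i n t : size (block X i n t) = n.
Proof. by rewrite size_map size_iota. Qed.

Lemma block_cat X i m n t :
  block X i (m + n) t = block X i m t ++ block X (i + m%:Z) n t.
Proof.
rewrite /block iotaD map_cat; congr (_ ++ _).
rewrite add0n (iota_shift m) -map_comp; apply: eq_map => j /=.
by rewrite PoszD addrA.
Qed.

Lemma block1 X i t : block X i 1 t = [:: X i t].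
Proof. by rewrite /block /= addr0. Qed.

Lemma block_rcons X i n t :
  block X i n.+1 t = rcons (block X i n t) (X (i + n%:Z) t).
Proof. by rewrite -addn1 block_cat block1 cats1. Qed.

Lemma block_cons X i n t : block X i n.+1 t = X i t :: block X (i + 1) n t.
Proof. by rewrite -add1n block_cat block1. Qed.

Lemma block_rev X i n t :
  rev (block X (i - n%:Z) n t) = [seq X (i - 1 - j%:Z) t | j <- iota 0 n].
Proof.
elim: n i => [//|n IH] i.
rewrite block_rcons rev_rcons -[RHS]/(_ :: map _ (iota 1 n)).
have -> : i - n.+1%:Z + n%:Z = i - 1 by rewrite intS; ring.
have -> : i - n.+1%:Z = i - 1 - n%:Z by rewrite intS; ring.
rewrite subr0 IH; congr (_ :: _).
rewrite (iota_shift 1) -map_comp; apply: eq_map => j /=.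
by rewrite add1n intS opprD addrA.
Qed.

Lemma measurable_block X i n w : measurable [set t | block X i n t = w].
Proof.
rewrite (_ : mkset _ =
  [set t | [seq X k t | k <- [seq i + j%:Z | j <- iota 0 n]] = w]).
  exact: measurable_map_event.
by apply/eq_set => t; rewrite -map_comp.
Qed.

Lemma probability_split q (Z : {RV P >-> nat}) (D : set T) : measurable D ->
  (forall t, (1 <= Z t <= q)%N) ->
  P D = (\sum_(a <- iota 1 q) P (D `&` [set t | Z t = a]))%E.
Proof.
move=> mD Zq; rewrite iota_shift big_map.
rewrite -[in iota 0 q](subn0 q) -/(index_iota 0 q) big_mkord.
pose F a := D `&` [set t | Z t = (1 + a)%N].
rewrite -(measure_bigsetU _ (F := F)); last first.
- apply/trivIsetP => a b _ _ ab; apply/seteqP; split=> // t [[_ /= Za] [_ /= Zb]].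
  by move: ab; rewrite (addnI (etrans (esym Za) Zb)) eqxx.
- move=> a; apply: measurableI => //.
  by have := measurable_funPTI Z (Y := [set (1 + a)%N]); apply.
congr (P _); rewrite -bigcup_mkord; apply/seteqP; split=> [t Dt|t [a _ []//]].
have /andP[Z1 Z2] := Zq t.
by exists (Z t).-1; [rewrite /= prednK|split=> //=; rewrite add1n prednK].
Qed.

End Blocks.

(** * Processes with a consistent block law *)

Section ProcessWithBlockLaw.
Context {d : measure_display} {T : measurableType d} {R : realType}
  {P : probability T R} (q : nat) (p : seq nat -> R)
  (X : int -> {RV P >-> nat}).
Hypothesis p_law : block_law (iota 1 q) p.
Hypothesis X_range : forall i t, (1 <= X i t <= q)%N.

Definition has_block_law i n :=
  forall w, size w = n -> P [set t | block X i n t = w] = (p w)%:E.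

Lemma has_block_law_left i n : has_block_law i n.+1 -> has_block_law i n.
Proof.
move=> law w wn.
rewrite (probability_split (q := q) (Z := X (i + n%:Z))) //; last first.
  exact: measurable_block.
rewrite -(block_sum_rcons p_law) -sumEFin; apply: eq_bigr => a _.
rewrite -law ?size_rcons ?wn //; congr (P _); apply/seteqP.
by split=> t /=; rewrite block_rcons; [case=> -> ->|move=> /rcons_inj[]].
Qed.

Lemma has_block_law_right i n : has_block_law i n.+1 -> has_block_law (i + 1) n.
Proof.
move=> law w wn.
rewrite (probability_split (q := q) (Z := X i)) //; last first.
  exact: measurable_block.
rewrite -(block_sum_cons p_law) -sumEFin; apply: eq_bigr => a _.
rewrite -law /= ?wn //; congr (P _); apply/seteqP.
by split=> t /=; rewrite block_cons; [case=> -> ->|case].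
Qed.

Lemma has_block_law_sub i m n k :
  has_block_law i (m + n + k) -> has_block_law (i + m%:Z) n.
Proof.
elim: k => [|k IH]; last by rewrite addnS => /has_block_law_left.
elim: m i => [|m IH] i; first by rewrite addn0 add0n addr0.
rewrite !addSn => /has_block_law_right/IH.
by rewrite -addrA -intS.
Qed.

Hypothesis X_law : forall i n, has_block_law i n.

(** The joint law that [p] prescribes for two blocks [k] sites apart. *)
Fixpoint gap_sum k (x y : seq nat) : R :=
  if k is j.+1 then \sum_(a <- iota 1 q) gap_sum j (rcons x a) y else p (x ++ y).

Lemma block_gap k i m n u v : size u = m -> size v = n ->
  P ([set t | block X i m t = u] `&` [set t | block X (i + m%:Z + k%:Z) n t = v])
  = (gap_sum k u v)%:E.
Proof.
elim: k m u => [|k IH] m u um vn.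
  rewrite addr0 /= -(X_law i (n := (m + n)%N)) ?size_cat ?um ?vn //.
  congr (P _); apply/seteqP.
  split=> t /=; rewrite block_cat; first by case=> -> ->.
  by move/eqP; rewrite eqseq_cat ?size_block // => /andP[/eqP -> /eqP ->].
rewrite (probability_split (q := q) (Z := X (i + m%:Z))) //; last first.
  by apply: measurableI; exact: measurable_block.
rewrite -sumEFin; apply: eq_bigr => a _.
rewrite -(IH m.+1) ?size_rcons ?um //.
have -> : i + m.+1%:Z + k%:Z = i + m%:Z + k.+1%:Z by rewrite !intS; ring.
rewrite setIAC; congr (P (_ `&` _)); apply/seteqP.
by split=> t /=; rewrite block_rcons; [case=> -> ->|move=> /rcons_inj[]].
Qed.

Lemma block_law_stationary : stationary X.
Proof.
apply: equal_in_law_of_blocks => i n w.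
have E t : block (fun i => X (i + 1)) i n t = block X (i + 1) n t.
  by apply: eq_map => j; rewrite addrAC.
under [in RHS]eq_set do rewrite E.
have [wn|wn] := eqVneq (size w) n; first by rewrite !X_law.
have empty j : [set t | block X j n t = w] = set0.
  by rewrite -subset0 => t /= tw; move: wn; rewrite -tw size_block eqxx.
by rewrite !empty.
Qed.

Lemma block_law_dependent k :
  (forall x y, gap_sum k x y = p x * p y) -> k_dependent k X.
Proof.
move=> gap i; apply: independent_of_blocks => m n u v.
have -> : [set t | [seq X (i - 1 - j%:Z) t | j <- iota 0 m] = u] =
          [set t | block X (i - m%:Z) m t = rev u].
  apply/eq_set => t; rewrite -block_rev; apply/propext.
  by split=> [<-|->]; rewrite revK.
rewrite -/(block X (i + k%:Z) n _).
have [um|um] := eqVneq (size u) m; last first.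
  rewrite (_ : [set t | _ = rev u] = set0) ?set0I ?measure0 ?mul0e //.
  rewrite -subset0 => t /= tu; move: um.
  by rewrite -(size_rev u) -tu size_block eqxx.
have [vn|vn] := eqVneq (size v) n; last first.
  rewrite (_ : [set t | _ = v] = set0) ?setI0 ?measure0 ?mule0 //.
  by rewrite -subset0 => t /= tv; move: vn; rewrite -tv size_block eqxx.
have := @block_gap k (i - m%:Z) m n (rev u) v.
rewrite subrK gap size_rev => ->//.
by rewrite !X_law ?size_rev // EFinM.
Qed.

Lemma block_law_coloring : (forall a, p [:: a; a] = 0) -> q_coloring q X.
Proof.
move=> p_repeat; split=> //.
(* The bad event is covered by countably many null block events. *)
pose bad (o : option (int * nat)) : set T :=
  if o is Some (i, a) then [set t | block X i 2 t = [:: a; a]] else set0.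
change (P.-negligible (~` [set t | forall i, X i t <> X (i + 1) t])).
apply: (negligibleS (A := \bigcup_k bad (unpickle k))).
  move=> t /= /existsNP[i /contrapT Xi].
  exists (pickle (i, X i t)) => //; rewrite pickleK /=.
  by rewrite block_cons block1 -Xi.
apply: negligible_bigcup => k; case: (unpickle k) => [[i a]|] /=; last first.
  exact: negligible_set0.
exists [set t | block X i 2 t = [:: a; a]]; split=> //.
  exact: measurable_block.
by rewrite X_law ?p_repeat.
Qed.

End ProcessWithBlockLaw.

(** * From one-sided histories to a process on the integers *)

(** The letters of a history, most recent first, are placed at the right end
and at the left end of the window in turn, starting with the right end. *)
Fixpoint arrange (u : seq nat) : seq nat :=
  if u is a :: v then
    if odd (size v) then a :: arrange v else rcons (arrange v) a
  else [::].

Lemma all_arrange (e : pred nat) u : all e (arrange u) = all e u.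
Proof. by elim: u => //= a u IH; case: ifP; rewrite /= ?all_rcons IH. Qed.

Lemma arrange_inj u v : size u = size v -> arrange u = arrange v -> u = v.
Proof.
elim: u v => [|a u IH] [|b v] //= [uv]; rewrite uv.
by case: ifP => _ => [[->]|/rcons_inj[+ ->]] => /(IH _ uv) ->.
Qed.

Lemma arrange_surj w : exists2 u, size u = size w & arrange u = w.
Proof.
have [n] := ubnP (size w); elim: n w => // n IH w wn.
have [->|w0] := eqVneq w [::]; first by exists [::].
have [odd_w|even_w] := boolP (odd (size w).-1).
  case: w w0 wn odd_w => // a w _ wn /= odd_w.
  have [u uw wE] := IH w wn.
  by exists (a :: u); rewrite /= uw // odd_w wE.
case: (lastP w) w0 wn even_w => // {}w a _; rewrite size_rcons => wn /= even_w.
have [u uw wE] := IH w wn.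
by exists (a :: u); rewrite /= uw // (negbTE even_w) wE.
Qed.

Section Process.
Variables (R : realType) (q : nat) (p : seq nat -> R).
Hypothesis p_law : block_law (iota 1 q) p.

Let q_gt0 : (0 < q)%N.
Proof.
rewrite lt0n; apply/eqP => q0; have := block_sum_rcons p_law [::].
by rewrite q0 big_nil (block_nil p_law) => /esym/eqP; rewrite oner_eq0.
Qed.

Let f u := p (arrange u).

Let f_ge0 u : 0 <= f u. Proof. exact: block_ge0 p_law _. Qed.

Let f_nil : f [::] = 1. Proof. exact: block_nil p_law. Qed.

Let f_cons u : \sum_(a <- iota 1 q) f (a :: u) = f u.
Proof.
rewrite /f /=; case: (odd _).
  exact: block_sum_cons p_law _.
exact: block_sum_rcons p_law _.
Qed.

Let hist := history q f.

(** The length of the history that has just placed a letter at site [i]. *)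
Definition entry_time (i : int) : nat :=
  match i with Posz n => n.*2.+1 | Negz n => n.*2.+2 end.

Let coordinate (i : int) (t : measurableTypeR R) : nat :=
  head 1%N (hist (entry_time i) t).

Let measurable_coordinate i : measurable_fun setT (coordinate i).
Proof. exact: (measurable_of_history q_gt0 f_ge0 f_nil f_cons _ (head 1%N)). Qed.

Let X (i : int) : {RV (@unit_uniform R) >-> nat} :=
  HB.pack (coordinate i) (isMeasurableFun.Build _ _ _ _ _ (measurable_coordinate i)).

Let X_range i t : (1 <= X i t <= q)%N.
Proof.
suff : coordinate i t \in iota 1 q by rewrite mem_iota add1n ltnS.
by rewrite /coordinate; case: i => n; exact: next_letter_range.
Qed.

Let arrange_history n t : arrange (hist n.*2 t) = block X (- n%:Z) n.*2 t.
Proof.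
elim: n => [//|n IH].
rewrite doubleS block_cons block_rcons.
have -> : - n.+1%:Z + 1 = - n%:Z by rewrite intS; ring.
have -> : - n%:Z + n.*2%:Z = n%:Z by rewrite -addnn PoszD; ring.
by rewrite -IH /= size_history /= odd_double /= -NegzE.
Qed.

Let X_symmetric_law n : has_block_law p X (- n%:Z) n.*2.
Proof.
move=> w wn.
have [wq|nwq] := boolP (all (mem (iota 1 q)) w); last first.
  rewrite (block_out p_law nwq) (_ : mkset _ = set0) ?measure0 //.
  rewrite -subset0 => t /= tw; move: nwq; rewrite -tw => /negP; apply.
  apply/allP => a /mapP[j _ ->]; rewrite inE mem_iota add1n ltnS.
  exact: X_range.
have [u uw arr_u] := arrange_surj w.
have uq : all (mem (iota 1 q)) u by rewrite -all_arrange arr_u.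
rewrite -arr_u -[RHS](unit_uniform_history f_ge0 f_nil f_cons uq) uw wn.
congr (unit_uniform _); apply/seteqP; split=> t /=; rewrite -arrange_history.
  by apply: arrange_inj; rewrite size_history uw wn.
by rewrite /hist => ->.
Qed.

(** After [2 N] letters the window is [-N, N), so its law is [p] by
construction; every other block lies in such a window, and its law follows by
summing over the outer letters. *)
Lemma block_law_process :
  exists (P : probability (measurableTypeR R) R) (Y : int -> {RV P >-> nat}),
    (forall i t, (1 <= Y i t <= q)%N) /\ (forall i n, has_block_law p Y i n).
Proof.
exists (@unit_uniform R), X; split=> [//|i n].
pose N := (absz i + n)%N.
have := @X_symmetric_law N.
pose m := absz (i + N%:Z)%R.
have -> : N.*2 = (m + n + (N.*2 - m - n))%N by lia.
by move=> /(has_block_law_sub p_law X_range); have -> : - N%:Z + m%:Z = i by lia.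
Qed.

End Process.

Lemma block_law_dependent_coloring (R : realType) (q k : nat) (p : seq nat -> R) :
  block_law (iota 1 q) p -> (forall a, p [:: a; a] = 0) ->
  (forall x y, gap_sum q p k x y = p x * p y) ->
  exists (d : measure_display) (T : measurableType d) (P : probability T R)
     (X : int -> {RV P >-> nat}),
     [/\ stationary X, k_dependent k X & q_coloring q X].
Proof.
move=> p_law p_repeat p_gap.
have [P [X [X_range X_law]]] := block_law_process p_law.
exists _, (measurableTypeR R), P, X; split.
- exact: block_law_stationary X_law.
exact (block_law_dependent X_range X_law p_gap).
- exact: block_law_coloring.
Qed.

Theorem theorem1 (R : realType) :
  (exists (d : measure_display) (T : measurableType d) (P : probability T R)
     (X : int -> {RV P >-> nat}),
     [/\ stationary X, k_dependent 1 X & q_coloring 4 X]) /\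
  (exists (d : measure_display) (T : measurableType d) (P : probability T R)
     (X : int -> {RV P >-> nat}),
     [/\ stationary X, k_dependent 2 X & q_coloring 3 X]).
Proof.
split.
- apply: (@block_law_dependent_coloring R 4 1 (weight4 R (iota 1 4))).
  + by apply: weight4_block_law; rewrite ?iota_uniq.
  + exact: weight4_repeat.
  + move=> x y; rewrite -weight4_gap ?iota_uniq //=.
    by under eq_bigr do rewrite cat_rcons.
- apply: (@block_law_dependent_coloring R 3 2 (weight3 R (iota 1 3))).
  + by apply: weight3_block_law; rewrite ?iota_uniq.
  + exact: weight3_repeat.
  + move=> x y; rewrite -weight3_gap ?iota_uniq //=.
    by under eq_bigr do under eq_bigr do rewrite !cat_rcons.
Qed.
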